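(* The following two statements are equivalent: (1) for every stream $s$, $\neg\,\mathcal{G}\,(\mathcal{F}\,\mathit{red})\,s$ implies $\neg\,\mathcal{G}\,(\neg\,\mathcal{G}\,\mathit{blue})\,s$; (2) for every stream $s$, $\mathcal{G}\,(\neg\neg\,\mathcal{F}\,\mathit{red})\,s$ implies $\neg\neg\,\mathcal{G}\,(\mathcal{F}\,\mathit{red})\,s$.
   Context: The equivalence is to be proved constructively (intuitionistic type theory with inductive and coinductive definitions; no excluded middle, no Markov's principle). A color is one of $R$ (red), $B$ (blue). A stream is an element of the coinductive type whose only constructor forms $c\,s$ from a color $c$ and a stream $s$; streams are considered up to bisimilarity (equivalently, functions $\mathbb{N}\to\{R,B\}$ up to pointwise equality). $\mathit{red}\,s$ means $s=R\,s'$ for some $s'$; $\mathit{blue}\,s$ means $s=B\,s'$ for some $s'$. For a stream predicate $X$: $\mathcal{F}\,X$ is defined inductively by the rules: $X\,s$ implies $\mathcal{F}\,X\,s$; $\mathcal{F}\,X\,s$ implies $\mathcal{F}\,X\,(c\,s)$ for any color $c$. $\mathcal{G}\,X$ is defined coinductively by the rule: $X\,(c\,s)$ and $\mathcal{G}\,X\,s$ imply $\mathcal{G}\,X\,(c\,s)$. Negation is lifted to predicates pointwise: inside $\mathcal{G}(\cdot)$, $\neg\,\mathcal{G}\,\mathit{blue}$ is the predicate $t\mapsto\neg(\mathcal{G}\,\mathit{blue}\,t)$ and $\neg\neg\,\mathcal{F}\,\mathit{red}$ is the predicate $t\mapsto\neg\neg(\mathcal{F}\,\mathit{red}\,t)$.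 *)

(* Defs.v *)
From Stdlib Require Import Streams.

Inductive color : Set := R | B.

(* Streams are meant up to bisimilarity [EqSt]. Every stream [s] is provably
   equal to [Cons (hd s) (tl s)], so [red] and [blue], although stated with
   Leibniz equality, respect [EqSt], and [F], [G] and [neg] preserve this. *)
Definition stream : Set := Stream color.

Definition red (s : stream) : Prop := exists s', s = Cons R s'.
Definition blue (s : stream) : Prop := exists s', s = Cons B s'.

(* [F] and [G] have constructor-form rules where the library's [Exists] and
   [ForAll] use [tl]. *)
Inductive F (X : stream -> Prop) : stream -> Prop :=
| F_here s : X s -> F X s
| F_later c s : F X s -> F X (Cons c s).

CoInductive G (X : stream -> Prop) : stream -> Prop :=
| G_cons c s : X (Cons c s) -> G X s -> G X (Cons c s).

Definition neg (X : stream -> Prop) : stream -> Prop := fun s => ~ X s.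

(* Main.v *)
(** Constructively, [~ F red t] is equivalent to [G blue t], so the predicates
    [neg (G blue)] and [neg (neg (F red))] agree pointwise, hence also under [G].
    What remains is that [~ P -> ~ Q] and [Q -> ~ ~ P] are equivalent. *)
Require Import Defs.
From Stdlib Require Import Streams.

Lemma G_mono (X Y : stream -> Prop) :
  (forall s, X s -> Y s) -> forall s, G X s -> G Y s.
Proof.
  intros XY; cofix IH; intros s [c t Xct Gt].
  constructor; [exact (XY _ Xct) | exact (IH t Gt)].
Qed.

(** [F red s] reaches a red head after finitely many tails; [G blue] passes to each tail and so
    demands a blue head there. *)
Lemma F_red_not_G_blue s : F red s -> ~ G blue s.
Proof.
  induction 1 as [s [t ->] | c s _ IH]; intros Gs; inversion Gs as [c' s' Hb Ht].
  - destruct Hb as [u Hu]; discriminate Hu.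
  - exact (IH Ht).
Qed.

(** The head color is decidable: a red head contradicts the hypothesis at once; below a blue one,
    [F_later] carries the hypothesis over to the tail. *)
Lemma not_F_red_G_blue : forall s, ~ F red s -> G blue s.
Proof.
  cofix IH; intros [[|] t] nF.
  - exfalso; apply nF, F_here; now exists t.
  - constructor.
    + now exists t.
    + apply IH; intros Ft; exact (nF (F_later _ _ _ Ft)).
Qed.

Lemma not_G_blue_iff s : neg (G blue) s <-> neg (neg (F red)) s.
Proof.
  split.
  - intros nG nF; exact (nG (not_F_red_G_blue s nF)).
  - intros nnF Gs; apply nnF; intros Fs; exact (F_red_not_G_blue s Fs Gs).
Qed.

Theorem lemma4p11 :
  (forall s : stream, ~ G (F red) s -> ~ G (neg (G blue)) s) <->
  (forall s : stream, G (neg (neg (F red))) s -> ~ ~ G (F red) s).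
Proof.
  split; intros H s H1 H2.
  - apply (H s H2); revert H1; apply G_mono, not_G_blue_iff.
  (* [H1] refutes the double negation that [H] yields. *)
  - refine (H s _ H1); revert H2; apply G_mono, not_G_blue_iff.
Qed.
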